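(* Let $q,x,z$ be complex numbers with $0<|q|<1$, $z\neq 0$, and $zq^n\neq 1$, $xq^n\neq z$ for all integers $n\ge 1$. Then $$\frac{(xq;q)_\infty}{(zq;q)_\infty\,(xq/z;q)_\infty}=\frac{1}{(q;q)_\infty}\sum_{n\ge 1}(-1)^{n-1}\frac{(xq;q)_n}{(q;q)_{n-1}}\,q^{\binom{n+1}{2}}\left(\frac{1}{q^n(1-zq^n)}+\frac{x/z}{1-\frac{xq^n}{z}}\right).$$
   Context: Notation: $(A;q)_n=\prod_{m=0}^{n-1}(1-Aq^m)$ (with $(A;q)_0=1$) and $(A;q)_\infty=\prod_{m=0}^{\infty}(1-Aq^m)$. *)

(* Defs.v *)
From Stdlib Require Import Reals Lra Lia.
From Coquelicot Require Import Coquelicot.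

Open Scope C_scope.

Fixpoint qpoch (A q : C) (n : nat) : C :=
  match n with
  | O => 1
  | S m => qpoch A q m * (1 - A * q ^ m)
  end.

(* Coquelicot's [lim] is total, with an unspecified value on non-convergent
   filters; [qpoch_inf_correct] shows that the limit exists when |q| < 1. *)
Definition qpoch_inf (A q : C) : C :=
  lim (T := C_CompleteNormedModule) (filtermap (qpoch A q) eventually).

Lemma Cmod_qpoch_le (A q : C) (n : nat) :
  Cmod q < 1 -> Cmod (qpoch A q n) <= exp (Cmod A / (1 - Cmod q)).
Proof.
intros Hq.
assert (Hq0 := Cmod_ge_0 q). assert (HA0 := Cmod_ge_0 A).
assert (H : (Cmod (qpoch A q n)
             <= exp (Cmod A * (1 - Cmod q ^ n) / (1 - Cmod q)))%R).
{ induction n as [|n IH]; simpl qpoch.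
  - rewrite Cmod_1; simpl.
    replace (Cmod A * (1 - 1) / (1 - Cmod q))%R with 0%R by (field; lra).
    rewrite exp_0; lra.
  - rewrite Cmod_mult.
    replace (Cmod A * (1 - Cmod q ^ S n) / (1 - Cmod q))%R
      with (Cmod A * (1 - Cmod q ^ n) / (1 - Cmod q) + Cmod A * Cmod q ^ n)%R
      by (simpl; field; lra).
    rewrite exp_plus.
    apply Rmult_le_compat; try apply Cmod_ge_0; [exact IH|].
    apply Rle_trans with (1 + Cmod A * Cmod q ^ n)%R.
    + unfold Cminus; eapply Rle_trans; [apply Cmod_triangle|].
      rewrite Cmod_1, Cmod_opp, Cmod_mult, Cmod_pow; lra.
    + apply exp_ineq1_le. }
eapply Rle_trans; [exact H|].
assert (Hpow : (0 <= Cmod q ^ n)%R) by (apply pow_le; lra).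
assert (Hle : (Cmod A * (1 - Cmod q ^ n) / (1 - Cmod q)
               <= Cmod A / (1 - Cmod q))%R).
{ unfold Rdiv; apply Rmult_le_compat_r.
  - apply Rlt_le, Rinv_0_lt_compat; lra.
  - nra. }
destruct Hle as [Hlt|Heq].
- apply Rlt_le, exp_increasing, Hlt.
- rewrite Heq; lra.
Qed.

Lemma qpoch_inf_correct (A q : C) :
  Cmod q < 1 ->
  filterlim (qpoch A q) eventually (locally (qpoch_inf A q)).
Proof.
intros Hq.
set (M := exp (Cmod A / (1 - Cmod q))).
set (d := fun n : nat => qpoch A q (S n) - qpoch A q n : C).
assert (Hd : ex_series (K := C_AbsRing) (V := C_CompleteNormedModule) d).
{ apply (ex_series_le (K := C_AbsRing) (V := C_CompleteNormedModule))
    with (fun n => (M * Cmod A) * Cmod q ^ n)%R.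
  - intros n; change (norm (d n)) with (Cmod (d n)); unfold d; simpl qpoch.
    replace (qpoch A q n * (1 - A * q ^ n) - qpoch A q n)
      with (- (qpoch A q n * (A * q ^ n))) by ring.
    rewrite Cmod_opp, !Cmod_mult, Cmod_pow, Rmult_assoc.
    apply Rmult_le_compat_r; [|apply Cmod_qpoch_le, Hq].
    apply Rmult_le_pos; [apply Cmod_ge_0|apply pow_le, Cmod_ge_0].
  - apply (ex_series_scal (K := R_AbsRing) (V := R_NormedModule)
             (M * Cmod A)%R (fun n => Cmod q ^ n)%R).
    apply ex_series_geom; rewrite Rabs_pos_eq; [exact Hq|apply Cmod_ge_0]. }
assert (Hsum : forall n, sum_n (G := C_AbelianMonoid) d n
                         = qpoch A q (S n) - 1).
{ induction n as [|n IH].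
  - rewrite sum_O; reflexivity.
  - rewrite sum_Sn, IH; unfold d; change plus with Cplus.
    set (a := qpoch A q (S (S n))); set (b := qpoch A q (S n)).
    change ((b - 1 + (a - b))%C = (a - 1)%C :> C); ring. }
destruct Hd as [s Hs].
assert (Hlim : filterlim (qpoch A q) eventually
                 (locally (T := C_CompleteNormedModule) (s + 1))).
{ assert (HS : filterlim (fun n => qpoch A q (S n)) eventually
                 (locally (T := C_CompleteNormedModule) (s + 1))).
  { apply filterlim_ext
      with (fun n => plus (sum_n (G := C_AbelianMonoid) d n) (RtoC 1)).
    - intros n; rewrite Hsum.
      change ((qpoch A q (S n) - 1 + 1)%C = qpoch A q (S n) :> C); ring.
    - apply (filterlim_comp_2 (G := locally (T := C_NormedModule) s)
               (H := locally (T := C_NormedModule) (RtoC 1))).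
      + exact Hs.
      + apply filterlim_const.
      + apply (filterlim_plus (K := C_AbsRing) (V := C_NormedModule) s (RtoC 1)). }
  intros P HP; destruct (HS P HP) as [N HN].
  exists (S N); intros [|n] Hn; [lia|apply HN; lia]. }
apply (filterlim_locally (U := C_CompleteNormedModule)); intros eps.
apply (complete_cauchy (T := C_CompleteNormedModule)
         (filtermap (qpoch A q) eventually)).
- apply filtermap_proper_filter, eventually_filter.
- intros e; exists (s + 1).
  exact (proj1 (filterlim_locally (U := C_CompleteNormedModule) _ _) Hlim e).
Qed.

(* Main.v *)
(* Put w = x/z. The bracket in the series equals (1 - x q^(2n)) / (q^n D_n) with
   D_n = (1 - z q^n) (1 - w q^n) = q^n (a_n - u), where a_n = q^(-n) + x q^n and
   u = z + w. Hence 1 / ((zq;q)_N (wq;q)_N) is, up to a power of q, the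
   reciprocal of the polynomial prod_(n <= N) (a_n - u) in u, and
   a_j - a_n = (q^(-j) - q^(-n)) (1 - x q^(n+j)) makes its partial fraction
   expansion explicit. Multiplied by (xq;q)_(2N), this is a finite form of the
   identity, and the limit N -> oo follows by dominated convergence. *)

Require Import Defs.
From Stdlib Require Import Reals Lra Lia.
From Coquelicot Require Import Coquelicot.
From mathcomp Require binomial.

Open Scope C_scope.

(** * Finite q-Pochhammer symbols and finite sums *)

Lemma binomial2_S (n : nat) :
  binomial.binomial (S n) 2 = (binomial.binomial n 2 + n)%nat.
Proof. now rewrite binomial.binS, binomial.bin1. Qed.

Lemma qpoch_add (A q : C) (n k : nat) :
  qpoch A q (n + k) = qpoch A q n * qpoch (A * q ^ n) q k.
Proof.
induction k as [|k IH]; [rewrite Nat.add_0_r; simpl; ring|].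
rewrite Nat.add_succ_r; simpl qpoch; rewrite IH, Cpow_add_r; ring.
Qed.

Lemma qpoch_Sl (A q : C) (n : nat) :
  qpoch A q (S n) = (1 - A) * qpoch (A * q) q n.
Proof.
change (S n) with (1 + n)%nat; rewrite qpoch_add, Cpow_1_r; simpl; ring.
Qed.

Lemma qpoch_neq_0 (A q : C) (n : nat) :
  (forall k, A * q ^ k <> 1) -> qpoch A q n <> 0.
Proof.
intros H; induction n as [|n IH]; simpl.
- apply C1_nz.
- apply Cmult_neq_0; [exact IH|].
  intros E; apply (H n); rewrite <- (Cplus_0_l (A * q ^ n)), <- E; ring.
Qed.

Lemma Cpow_S_neq_1 (q : C) (n : nat) : Cmod q < 1 -> q ^ S n <> 1.
Proof.
intros Hq E; apply (f_equal Cmod) in E; rewrite Cmod_pow, Cmod_1 in E.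
assert (H := Cmod_ge_0 q).
assert (Cmod q ^ n <= 1)%R by (rewrite <- (pow1 n); apply pow_incr; lra).
assert (0 <= Cmod q ^ n)%R by (apply pow_le; lra).
simpl in E; nra.
Qed.

Lemma one_minus_neq_0 (a : C) : a <> 1 -> 1 - a <> 0.
Proof. intros H E; apply H; rewrite <- (Cplus_0_l a), <- E; ring. Qed.

Definition Csum (a : nat -> C) (n : nat) : C :=
  sum_n (G := C_AbelianMonoid) a n.

Lemma Csum_0 (a : nat -> C) : Csum a 0 = a 0%nat.
Proof. exact (sum_O (G := C_AbelianMonoid) a). Qed.

Lemma Csum_S (a : nat -> C) (n : nat) : Csum a (S n) = Csum a n + a (S n).
Proof. exact (sum_Sn (G := C_AbelianMonoid) a n). Qed.

Lemma Csum_lin (a b e : nat -> C) (c d : C) (n : nat) :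
  (forall k, (k <= n)%nat -> a k * d = b k + c * e k) ->
  Csum a n * d = Csum b n + c * Csum e n.
Proof.
induction n as [|n IH]; intros H.
- rewrite !Csum_0; now apply H.
- rewrite !Csum_S, Cmult_plus_distr_r, IH by (intros; apply H; lia).
  rewrite H by lia; ring.
Qed.

(** * The finite identity: explicit partial fractions *)

(** With n = m + 1, the n-th term of the series in the theorem is [weight x q m] / D_n: the q^n in
    the denominator of the bracket lowers the exponent binom(n+1,2) to binom(n,2). *)
Definition weight (x q : C) (m : nat) : C :=
  (-1) ^ m * q ^ binomial.binomial (S m) 2
  * (qpoch (x * q) q (S m) * (1 - x * q ^ (2 * m + 2))) / qpoch q q m.

(* The coefficient of [1 / D_(m+1)] in the partial fraction expansion for
   [N = M + 1], multiplied by [qpoch (x * q) q (2 * M + 2)] so that it still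
   makes sense when two poles collide, i.e. when [x * q ^ j = 1] for some [j]. *)
Definition pf_coef (x q : C) (M m : nat) : C :=
  weight x q m
  * (qpoch (x * q ^ (M + m + 3)) q (M - m) / qpoch q q (M - m)).

Lemma qpoch_q_neq_0 (q : C) (n : nat) : Cmod q < 1 -> qpoch q q n <> 0.
Proof.
intros hq1;
apply qpoch_neq_0; intros k; rewrite <- Cpow_S; now apply Cpow_S_neq_1.
Qed.

(** The sum has a closed form at every stage, found by induction on m with M = m + r fixed, so that
    r counts the terms still missing. The factor 1 - q^r makes the full sum vanish; 0 < m + r keeps
    the denominator 1 - q^(m+r) nonzero. *)
Lemma pf_coef_partial_sum (x q : C) (m r : nat) :
  Cmod q < 1 -> (0 < m + r)%nat ->
  Csum
    (fun k => pf_coef x q (m + r) k * q ^ (m + r - k)) m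
  = q ^ (m + r) * (-1) ^ m * q ^ binomial.binomial (S m) 2
    * qpoch (x * q) q (S (S m))
    * qpoch (x * q ^ (m + r + m + 3)) q r * (1 - q ^ r)
    / (qpoch q q m * qpoch q q r * (1 - q ^ (m + r))).
Proof.
intros hq1; revert r; induction m as [|m IH]; intros r Hr.
- rewrite Csum_0; unfold pf_coef, weight.
  rewrite !Nat.add_0_l, !Nat.sub_0_r.
  destruct r as [|r]; [lia|].
  assert (H1 := qpoch_q_neq_0 q (S r) hq1).
  assert (H2 := one_minus_neq_0 _ (Cpow_S_neq_1 q r hq1)).
  replace (S r + 0 + 3)%nat with (S r + 3)%nat by lia.
  set (E := qpoch (x * q ^ (S r + 3)) q (S r)).
  change (binomial.binomial 1 2) with 0%nat.
  set (Q := qpoch q q (S r)) in *; set (p := q ^ S r) in *.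
  simpl; field; auto.
- rewrite Csum_S.
  replace (S m + r)%nat with (m + S r)%nat in * by lia.
  rewrite IH by lia.
  unfold pf_coef, weight.
  replace (m + S r - S m)%nat with r by lia.
  assert (H1 := qpoch_q_neq_0 q m hq1). assert (H2 := qpoch_q_neq_0 q r hq1).
  assert (H3 := one_minus_neq_0 _ (Cpow_S_neq_1 q m hq1)).
  assert (H4 := one_minus_neq_0 _ (Cpow_S_neq_1 q r hq1)).
  assert (H5 : 1 - q ^ (m + S r) <> 0).
  { rewrite Nat.add_succ_r; apply one_minus_neq_0, Cpow_S_neq_1, hq1. }
  (* Peeling the first factor off the tail in the induction hypothesis leaves the tail of the new
     coefficient, so [E] becomes a common factor. *)
  rewrite (qpoch_Sl (x * q ^ (m + S r + m + 3))).
  replace (x * q ^ (m + S r + m + 3) * q) with (x * q ^ (m + S r + S m + 3)).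
  2:{ replace (m + S r + S m + 3)%nat with (S (m + S r + m + 3)) by lia.
      rewrite Cpow_S; ring. }
  set (E := qpoch (x * q ^ (m + S r + S m + 3)) q r).
  rewrite (binomial2_S (S m)).
  rewrite (Cpow_add_r q (binomial.binomial (S m) 2)).
  set (B := q ^ binomial.binomial (S m) 2).
  change (qpoch (x * q) q (S (S (S m)))) with
    (qpoch (x * q) q (S (S m)) * (1 - x * q * q ^ (S (S m)))).
  set (X := qpoch (x * q) q (S (S m))).
  change (qpoch q q (S m)) with (qpoch q q m * (1 - q * q ^ m)).
  change (qpoch q q (S r)) with (qpoch q q r * (1 - q * q ^ r)).
  set (P := qpoch q q m) in *; set (Q := qpoch q q r) in *.
  rewrite !Cpow_S.
  replace (2 * S m + 2)%nat with (m + m + 4)%nat by lia.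
  rewrite !Cpow_add_r, !Cpow_S in *.
  (* With the common symbols opaque, what remains is a rational identity in q, x, q^m and q^r. *)
  set (a := q ^ m) in *; set (c := q ^ r) in *; set (s := (-1) ^ m).
  change (q ^ 0) with (RtoC 1).
  field; repeat split; auto.
Qed.

(** The case r = 0, where 1 - q^r vanishes. Since 1 / D_n = q^(-n) / (a_n - u), this says, up to a
    power of q, that the expansion has no 1/u term at infinity, as it must with at least two
    poles. *)
Lemma pf_coef_balanced (x q : C) (M : nat) : Cmod q < 1 ->
  Csum
    (fun k => pf_coef x q (S M) k * q ^ (S M - k)) (S M) = 0.
Proof.
intros hq1; assert (H := pf_coef_partial_sum x q (S M) 0 hq1 ltac:(lia)).
rewrite !Nat.add_0_r in H; rewrite H.
change (q ^ 0) with (RtoC 1); unfold Cdiv; ring.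
Qed.

(* The induction on [M] uses that, with [D n = (1 - z q^n) (1 - w q^n)],
   [D (M + 2) / D n = q^(M+2-n) + (1 - q^(M+2-n)) (1 - z w q^(M+2+n)) / D n];
   the contribution of the first summand vanishes by [pf_coef_balanced]. *)
Lemma partial_fractions (q z w : C) (M : nat) :
  Cmod q < 1 ->
  (forall n, z * q ^ S n <> 1) -> (forall n, w * q ^ S n <> 1) ->
  Csum
    (fun m => pf_coef (z * w) q M m
              / ((1 - z * q ^ S m) * (1 - w * q ^ S m))) M
  = qpoch (z * w * q) q (2 * M + 2)
    / (qpoch (z * q) q (S M) * qpoch (w * q) q (S M)).
Proof.
intros hq hz hw.
assert (Hz : forall n, 1 - z * q ^ S n <> 0)
  by (intros; now apply one_minus_neq_0).
assert (Hw : forall n, 1 - w * q ^ S n <> 0)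
  by (intros; now apply one_minus_neq_0).
induction M as [|M IH].
- rewrite Csum_0; unfold pf_coef, weight.
  specialize (Hz 0%nat); specialize (Hw 0%nat).
  change (binomial.binomial 1 2) with 0%nat.
  rewrite Cpow_1_r in *.
  simpl; field; rewrite ?Cmult_1_r; auto.
- set (D := (1 - z * q ^ S (S M)) * (1 - w * q ^ S (S M))).
  assert (HD : D <> 0) by (apply Cmult_neq_0; auto).
  assert (HPz : forall n, qpoch (z * q) q n <> 0).
  { intros n; apply qpoch_neq_0; intros k; rewrite <- Cmult_assoc, <- Cpow_S; auto. }
  assert (HPw : forall n, qpoch (w * q) q n <> 0).
  { intros n; apply qpoch_neq_0; intros k; rewrite <- Cmult_assoc, <- Cpow_S; auto. }
  (* The constant is (zwq;q)_(2M+4) / (zwq;q)_(2M+2), the ratio of the right-hand numerators for M +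
     1 and M. *)
  assert (Hstep := Csum_lin
    (fun m => pf_coef (z * w) q (S M) m
              / ((1 - z * q ^ S m) * (1 - w * q ^ S m)))
    (fun m => pf_coef (z * w) q (S M) m * q ^ (S M - m))
    (fun m => pf_coef (z * w) q M m
              / ((1 - z * q ^ S m) * (1 - w * q ^ S m)))
    ((1 - z * w * q ^ (2 * M + 3)) * (1 - z * w * q ^ (2 * M + 4))) D M).
  assert (Hbal := pf_coef_balanced (z * w) q M hq).
  rewrite Csum_S in Hbal |- *.
  rewrite IH in Hstep.
  match goal with |- ?s + ?t = _ => set (S1 := s) in *; set (t1 := t) in * end.
  (* The new pole has no counterpart in the sum for M; multiplied by [D], its term is exactly the
     last term of the vanishing sum [Hbal]. *)
  assert (Ht : t1 * D = pf_coef (z * w) q (S M) (S M) * q ^ (S M - S M)).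
  { unfold t1; fold D; rewrite Nat.sub_diag; change (q ^ 0) with (RtoC 1); field; exact HD. }
  assert (HE : (S1 + t1) * D =
    (1 - z * w * q ^ (2 * M + 3)) * (1 - z * w * q ^ (2 * M + 4)) *
    (qpoch (z * w * q) q (2 * M + 2)
     / (qpoch (z * q) q (S M) * qpoch (w * q) q (S M)))).
  { rewrite Cmult_plus_distr_r, Ht, Hstep.
    - match type of Hbal with ?u + ?v = _ =>
        match goal with |- _ + ?t + _ = _ =>
          transitivity (u + v + t); [ring|rewrite Hbal; ring] end end.
    - intros m Hm.
      assert (exists r, M = (m + r)%nat) as [r Hr] by (exists (M - m)%nat; lia).
      unfold D; clear - Hr hq Hz Hw; subst M; unfold pf_coef.
      replace (S (m + r) - m)%nat with (S r) by lia.
      replace (m + r - m)%nat with r by lia.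
      (* The factor 1 - z w q^(M+m+3) extends the tail for M + 1 downwards; its last two factors are
         the constant of [Hstep], and the others form the tail for M. *)
      assert (HX : (1 - z * w * q ^ (m + r + m + 3))
          * qpoch (z * w * q ^ (S (m + r) + m + 3)) q (S r)
        = qpoch (z * w * q ^ (m + r + m + 3)) q r
          * (1 - z * w * q ^ (2 * (m + r) + 3))
          * (1 - z * w * q ^ (2 * (m + r) + 4))).
      { replace (z * w * q ^ (S (m + r) + m + 3))
          with (z * w * q ^ (m + r + m + 3) * q)
          by (change (S (m + r) + m + 3)%nat with (S (m + r + m + 3));
              rewrite Cpow_S; ring).
        rewrite <- qpoch_Sl; simpl qpoch.
        replace (2 * (m + r) + 3)%nat with (m + r + m + 3 + r)%nat by lia.
        replace (2 * (m + r) + 4)%nat with (m + r + m + 3 + S r)%nat by lia.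
        rewrite !Cpow_add_r, !Cpow_S; ring. }
      assert (H2 := qpoch_q_neq_0 q r hq).
      assert (H3 := one_minus_neq_0 _ (Cpow_S_neq_1 q r hq)).
      assert (H4 := Hz m). assert (H5 := Hw m).
      change (qpoch q q (S r)) with (qpoch q q r * (1 - q ^ S r)).
      set (W := weight (z * w) q m).
      set (E := qpoch (z * w * q ^ (m + r + m + 3)) q r) in *.
      set (E' := qpoch (z * w * q ^ (S (m + r) + m + 3)) q (S r)) in *.
      set (Q := qpoch q q r) in *.
      set (e1 := z * w * q ^ (2 * (m + r) + 3)) in *.
      set (e2 := z * w * q ^ (2 * (m + r) + 4)) in *.
      (* In the second summand the factor 1 - q^(r+1) of the splitting has cancelled the last factor
         of (q;q)_(r+1), leaving the denominator of the coefficient for M. *)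
      transitivity (W * (E' / (Q * (1 - q ^ S r))) * q ^ S r +
        W * (((1 - z * w * q ^ (m + r + m + 3)) * E') / Q)
        / ((1 - z * q ^ S m) * (1 - w * q ^ S m))).
      2:{ rewrite HX; field; auto. }
      replace (m + r + m + 3)%nat with (S m + S (S m + r))%nat by lia.
      replace (S (S (m + r)))%nat with (S m + S r)%nat by lia.
      replace (S (S m + r))%nat with (S m + S r)%nat by lia.
      rewrite !Cpow_add_r.
      set (a := q ^ S m) in *; set (c := q ^ S r) in *.
      field; auto. }
  apply (f_equal (fun t => t / D)) in HE.
  replace ((S1 + t1) * D / D) with (S1 + t1) in HE by (field; exact HD).
  rewrite HE; clear - HPz HPw HD Hz Hw.
  replace (2 * S M + 2)%nat with (S (S (2 * M + 2))) by lia.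
  assert (H1 := HPz (S M)); assert (H2 := HPw (S M)).
  assert (H3 := Hz (S M)); assert (H4 := Hw (S M)).
  replace (2 * M + 3)%nat with (S (2 * M + 2)) by lia.
  replace (2 * M + 4)%nat with (S (S (2 * M + 2))) by lia.
  unfold D.
  change (qpoch (z * q) q (S (S M))) with
    (qpoch (z * q) q (S M) * (1 - z * q * q ^ (S M))).
  change (qpoch (w * q) q (S (S M))) with
    (qpoch (w * q) q (S M) * (1 - w * q * q ^ (S M))).
  change (qpoch (z * w * q) q (S (S (2 * M + 2)))) with
    (qpoch (z * w * q) q (2 * M + 2) * (1 - z * w * q * q ^ (2 * M + 2))
     * (1 - z * w * q * q ^ S (2 * M + 2))).
  rewrite !(Cpow_S q (S _)), !(Cpow_S q (2 * M + 2)) in *.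
  set (p := qpoch (z * q) q (S M)) in *.
  set (p' := qpoch (w * q) q (S M)) in *.
  set (u := q ^ S M) in *; set (v := q ^ (2 * M + 2)).
  field; rewrite <- ?Cmult_assoc; auto.
Qed.

(** * Limits of complex sequences and dominated convergence *)

(** Encoded by the real sequence of distances, so that squeezing and the arithmetic of real limits
    apply; [ctends_filterlim] translates back to filters. *)
Definition ctends (u : nat -> C) (l : C) : Prop :=
  is_lim_seq (fun n => Cmod (u n - l)) 0.

Lemma ctends_eps (u : nat -> C) (l : C) :
  ctends u l <->
  forall eps : posreal,
    exists N, forall n, (N <= n)%nat -> (Cmod (u n - l) < eps)%R.
Proof.
unfold ctends; rewrite <- is_lim_seq_spec; simpl.
split; intros H eps; destruct (H eps) as [N HN]; exists N; intros n Hn;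
  specialize (HN n Hn); rewrite Rminus_0_r, Rabs_pos_eq in *;
  auto using Cmod_ge_0.
Qed.

Lemma ctends_filterlim (u : nat -> C) (l : C) :
  ctends u l <->
  filterlim u eventually (locally (T := C_NormedModule) l).
Proof.
rewrite ctends_eps.
rewrite (filterlim_locally_ball_norm (K := C_AbsRing) (U := C_NormedModule)).
reflexivity.
Qed.

Lemma ctends_squeeze (u : nat -> C) (l : C) (e : nat -> R) :
  (forall n, (Cmod (u n - l) <= e n)%R) -> is_lim_seq e 0 -> ctends u l.
Proof.
intros H He; apply is_lim_seq_le_le with (fun _ => 0%R) e; auto.
- intros n; split; [apply Cmod_ge_0|apply H].
- apply is_lim_seq_const.
Qed.

Lemma ctends_const (l : C) : ctends (fun _ => l) l.
Proof.
apply ctends_squeeze with (fun _ => 0%R); [|apply is_lim_seq_const].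
intros n; unfold Cminus; rewrite Cplus_opp_r, Cmod_0; lra.
Qed.

Lemma ctends_mult (u v : nat -> C) (l m : C) :
  ctends u l -> ctends v m -> ctends (fun n => u n * v n) (l * m).
Proof.
intros Hu Hv.
apply ctends_squeeze with (fun n =>
  Cmod (u n - l) * (Cmod (v n - m) + Cmod m) + Cmod l * Cmod (v n - m))%R.
- intros n.
  replace (u n * v n - l * m)
    with ((u n - l) * ((v n - m) + m) + l * (v n - m)) by ring.
  eapply Rle_trans; [apply Cmod_triangle|]; rewrite !Cmod_mult.
  apply Rplus_le_compat_r, Rmult_le_compat_l;
    [apply Cmod_ge_0|apply Cmod_triangle].
- replace (Finite 0) with (Finite (0 * (0 + Cmod m) + Cmod l * 0))
    by (f_equal; ring).
  apply is_lim_seq_plus'; apply is_lim_seq_mult'; auto using is_lim_seq_const.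
  apply is_lim_seq_plus'; auto using is_lim_seq_const.
Qed.

Lemma ctends_Cmod_ge (u : nat -> C) (l : C) (c : R) :
  ctends u l -> (forall n, (c <= Cmod (u n))%R) -> (c <= Cmod l)%R.
Proof.
intros Hu Hc; apply Rnot_lt_le; intros Hlt.
assert (He : (0 < c - Cmod l)%R) by lra.
destruct (proj1 (ctends_eps u l) Hu (mkposreal _ He)) as [N HN].
specialize (HN N (le_n N)); specialize (Hc N); simpl in HN.
assert (H := Cmod_triangle (u N - l) l).
replace (u N - l + l) with (u N) in H by ring; lra.
Qed.

Lemma ctends_inv (u : nat -> C) (l : C) (c : R) :
  (0 < c)%R -> (forall n, (c <= Cmod (u n))%R) -> ctends u l ->
  ctends (fun n => / u n) (/ l).
Proof.
intros Hc0 Hc Hu.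
assert (Hl := ctends_Cmod_ge u l c Hu Hc).
apply ctends_squeeze with (fun n => (Cmod (u n - l) * / (c * c))%R).
- intros n; specialize (Hc n).
  assert (Hun : u n <> 0) by (apply Cmod_gt_0; lra).
  assert (Hln : l <> 0) by (apply Cmod_gt_0; lra).
  replace (/ u n - / l) with (- ((u n - l) * / (u n * l))) by (field; auto).
  rewrite Cmod_opp, Cmod_mult, Cmod_inv, Cmod_mult by (now apply Cmult_neq_0).
  apply Rmult_le_compat_l; [apply Cmod_ge_0|].
  apply Rinv_le_contravar; [nra|]; apply Rmult_le_compat; lra.
- replace (Finite 0) with (Finite (0 * / (c * c))) by (f_equal; ring).
  apply is_lim_seq_mult'; auto using is_lim_seq_const.
Qed.

Lemma ctends_subseq (u : nat -> C) (l : C) (f : nat -> nat) :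
  filterlim f eventually eventually -> ctends u l ->
  ctends (fun n => u (f n)) l.
Proof.
intros Hf Hu.
exact (is_lim_seq_subseq (fun n => Cmod (u n - l)) 0 f Hf Hu).
Qed.

Lemma ctends_Csum (a : nat -> nat -> C) (b : nat -> C) (K : nat) :
  (forall m, ctends (fun M => a M m) (b m)) ->
  ctends (fun M => Csum (a M) K) (Csum b K).
Proof.
intros H; induction K as [|K IH].
- rewrite Csum_0; apply (is_lim_seq_ext (fun M => Cmod (a M 0%nat - b 0%nat)));
    [intros M; now rewrite Csum_0|apply H].
- apply ctends_squeeze with (fun M =>
    (Cmod (Csum (a M) K - Csum b K) + Cmod (a M (S K) - b (S K)))%R).
  + intros M; rewrite !Csum_S.
    replace (Csum (a M) K + a M (S K) - (Csum b K + b (S K)))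
      with ((Csum (a M) K - Csum b K) + (a M (S K) - b (S K))) by ring.
    apply Cmod_triangle.
  + replace (Finite 0) with (Finite (0 + 0)) by (f_equal; ring).
    apply is_lim_seq_plus'; [exact IH|apply H].
Qed.

(* Tannery's theorem. *)
Lemma is_series_of_dominated (a : nat -> nat -> C) (b : nat -> C)
    (B : nat -> R) (l : C) :
  (forall m, ctends (fun M => a M m) (b m)) ->
  (forall M m, (Cmod (a M m) <= B m)%R) ->
  ex_series B ->
  ctends (fun M => Csum (a M) M) l ->
  is_series (K := C_AbsRing) (V := C_NormedModule) b l.
Proof.
intros Hab HB HBs Hl.
apply (ctends_filterlim (Csum b)), ctends_eps; intros eps.
assert (He : (0 < eps / 3)%R) by (destruct eps; simpl; lra).
set (e3 := mkposreal _ He).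
destruct (Cauchy_ex_series B HBs e3) as [N HN].
exists N; intros K HK.
destruct (proj1 (ctends_eps _ _) (ctends_Csum a b K Hab) e3) as [N1 H1].
destruct (proj1 (ctends_eps _ _) Hl e3) as [N2 H2].
(* A single row M beyond all thresholds: the sum of [b] up to K is compared with the row sum up to
   K, then with the whole row sum, then with [l], each at a cost below eps/3. *)
set (M := (S K + N1 + N2)%nat).
specialize (H1 M ltac:(lia)); specialize (H2 M ltac:(lia)).
assert (H3 : (Cmod (Csum (a M) M - Csum (a M) K) < e3)%R).
{ set (T := sum_n_m (G := C_AbelianMonoid) (a M) (S K) M : C).
  assert (Hsplit : Csum (a M) M = Csum (a M) K + T)
    by (apply (sum_n_m_Chasles (G := C_AbelianMonoid)); lia).
  rewrite Hsplit.
  replace (Csum (a M) K + T - Csum (a M) K) with T by ring.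
  eapply Rle_lt_trans;
    [exact (norm_sum_n_m (K := C_AbsRing) (V := C_NormedModule) (a M) _ _)|].
  eapply Rle_lt_trans; [apply (sum_n_m_le _ B); intros k; apply HB|].
  eapply Rle_lt_trans; [apply Rle_abs|].
  apply HN; lia. }
replace (Csum b K - l) with
  (- (Csum (a M) K - Csum b K) + (- (Csum (a M) M - Csum (a M) K)
   + (Csum (a M) M - l))) by ring.
eapply Rle_lt_trans; [apply Cmod_triangle|].
eapply Rle_lt_trans;
  [apply Rplus_le_compat_l, Cmod_triangle|].
rewrite !Cmod_opp; simpl in *; lra.
Qed.

(** * Uniform bounds and limits of q-Pochhammer symbols *)

(** Telescoping: the k-th increment is -A q^k (A;q)_k, the symbol is bounded by the exponential, and
    the powers of |q| sum geometrically. The factor |A| makes the symbol close to 1 for small A,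
    uniformly in n. *)
Lemma Cmod_qpoch_sub_1 (A q : C) (n : nat) : Cmod q < 1 ->
  (Cmod (qpoch A q n - 1)
   <= exp (Cmod A / (1 - Cmod q)) / (1 - Cmod q) * Cmod A)%R.
Proof.
intros Hq.
assert (Hq0 := Cmod_ge_0 q). assert (HA0 := Cmod_ge_0 A).
set (E := exp (Cmod A / (1 - Cmod q))).
assert (HE : (0 < E)%R) by apply exp_pos.
assert (H : (Cmod (qpoch A q n - 1)
             <= E * Cmod A * ((1 - Cmod q ^ n) / (1 - Cmod q)))%R).
{ induction n as [|n IH].
  - simpl; unfold Cminus, Rdiv; rewrite Cplus_opp_r, Cmod_0; nra.
  - simpl qpoch.
    replace (qpoch A q n * (1 - A * q ^ n) - 1)
      with ((qpoch A q n - 1) + - (qpoch A q n * (A * q ^ n))) by ring.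
    eapply Rle_trans; [apply Cmod_triangle|].
    rewrite Cmod_opp, !Cmod_mult, Cmod_pow.
    replace (E * Cmod A * ((1 - Cmod q ^ S n) / (1 - Cmod q)))%R
      with (E * Cmod A * ((1 - Cmod q ^ n) / (1 - Cmod q))
            + E * (Cmod A * Cmod q ^ n))%R by (simpl; field; lra).
    apply Rplus_le_compat; [exact IH|].
    apply Rmult_le_compat_r; [|now apply Cmod_qpoch_le].
    apply Rmult_le_pos; [lra|apply pow_le; lra]. }
eapply Rle_trans; [exact H|].
replace (E / (1 - Cmod q) * Cmod A)%R
  with (E * Cmod A * (1 / (1 - Cmod q)))%R by (field; lra).
apply Rmult_le_compat_l; [nra|].
apply Rmult_le_compat_r; [apply Rlt_le, Rinv_0_lt_compat; lra|].
assert (0 <= Cmod q ^ n)%R by (apply pow_le; lra); lra.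
Qed.

(** Freezes the exponential at [K], so that the bound is linear in |A| with a constant common to a
    bounded family of A. *)
Lemma Cmod_qpoch_sub_1_le (A q : C) (K : R) (n : nat) : Cmod q < 1 ->
  (Cmod A <= K)%R ->
  (Cmod (qpoch A q n - 1)
   <= exp (K / (1 - Cmod q)) / (1 - Cmod q) * Cmod A)%R.
Proof.
intros Hq HK; eapply Rle_trans; [now apply Cmod_qpoch_sub_1|].
assert (Hi : (0 < / (1 - Cmod q))%R) by (apply Rinv_0_lt_compat; lra).
apply Rmult_le_compat_r; [apply Cmod_ge_0|].
apply Rmult_le_compat_r; [lra|].
assert (Hle : (Cmod A / (1 - Cmod q) <= K / (1 - Cmod q))%R)
  by (apply Rmult_le_compat_r; lra).
destruct Hle as [Hlt| ->]; [apply Rlt_le, exp_increasing, Hlt|lra].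
Qed.

Lemma Cmod_mult_pow_lim (A q : C) : Cmod q < 1 ->
  is_lim_seq (fun n => Cmod (A * q ^ n)) 0.
Proof.
intros Hq.
apply is_lim_seq_ext with (fun n => (Cmod A * Cmod q ^ n)%R).
- intros n; now rewrite Cmod_mult, Cmod_pow.
- replace (Finite 0) with (Finite (Cmod A * 0)) by (f_equal; ring).
  apply is_lim_seq_mult'; [apply is_lim_seq_const|].
  apply is_lim_seq_geom; rewrite Rabs_pos_eq; [exact Hq|apply Cmod_ge_0].
Qed.

Lemma ctends_qpoch_1 (A : nat -> C) (q : C) (k : nat -> nat) (K : R) :
  Cmod q < 1 -> (forall n, (Cmod (A n) <= K)%R) ->
  is_lim_seq (fun n => Cmod (A n)) 0 ->
  ctends (fun n => qpoch (A n) q (k n)) 1.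
Proof.
intros Hq HK HA.
apply ctends_squeeze with
  (fun n => exp (K / (1 - Cmod q)) / (1 - Cmod q) * Cmod (A n))%R.
- intros n; now apply Cmod_qpoch_sub_1_le.
- match goal with |- is_lim_seq (fun n => (?c * _)%R) _ =>
    replace (Finite 0) with (Finite (c * 0)) by (f_equal; ring) end.
  apply is_lim_seq_mult'; [apply is_lim_seq_const|exact HA].
Qed.

Lemma Cmod_mult_pow_le (A q : C) (n : nat) : Cmod q < 1 ->
  (Cmod (A * q ^ n) <= Cmod A)%R.
Proof.
intros Hq; rewrite Cmod_mult, Cmod_pow.
assert (Hq0 := Cmod_ge_0 q). assert (HA0 := Cmod_ge_0 A).
assert (Cmod q ^ n <= 1)%R by (rewrite <- (pow1 n); apply pow_incr; lra).
nra.
Qed.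

(** Beyond some index n0 the remaining product stays within 1/2 of 1, and the finitely many earlier
    partial products are nonzero. *)
Lemma qpoch_bounded_below (A q : C) : Cmod q < 1 ->
  (forall k, A * q ^ k <> 1) ->
  exists c, (0 < c)%R /\ forall n, (c <= Cmod (qpoch A q n))%R.
Proof.
intros Hq HA.
assert (Htail : exists n0, forall k,
          (1 / 2 <= Cmod (qpoch (A * q ^ n0) q k))%R).
{ set (c := (exp (Cmod A / (1 - Cmod q)) / (1 - Cmod q))%R).
  assert (Hc : (0 < c)%R)
    by (apply Rdiv_lt_0_compat; [apply exp_pos|lra]).
  (* The threshold 1/(2c) turns the bound c |A q^n0| on the distance from 1 into 1/2. *)
  assert (He : (0 < / (2 * c))%R) by (apply Rinv_0_lt_compat; lra).
  destruct (proj2 (is_lim_seq_spec _ _) (Cmod_mult_pow_lim A q Hq)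
              (mkposreal _ He)) as [n0 Hn0].
  specialize (Hn0 n0 (le_n n0)); simpl in Hn0.
  rewrite Rminus_0_r, Rabs_pos_eq in Hn0 by apply Cmod_ge_0.
  exists n0; intros k.
  set (P := qpoch (A * q ^ n0) q k).
  assert (HP : (Cmod (P - 1) <= c * Cmod (A * q ^ n0))%R)
    by (apply Cmod_qpoch_sub_1_le; [exact Hq|now apply Cmod_mult_pow_le]).
  assert (Hs : (c * Cmod (A * q ^ n0) < c * / (2 * c))%R)
    by (apply Rmult_lt_compat_l; lra).
  replace (c * / (2 * c))%R with (1 / 2)%R in Hs by (field; lra).
  assert (Ht := Cmod_triangle P (- (P - 1))).
  replace (P + - (P - 1)) with (RtoC 1) in Ht by ring.
  rewrite Cmod_opp, Cmod_1 in Ht; lra. }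
destruct Htail as [n0 Hn0].
assert (Hinit : exists c, (0 < c)%R /\
          forall n, (n <= n0)%nat -> (c <= Cmod (qpoch A q n))%R).
{ clear Hn0; induction n0 as [|n0 [c [Hc IH]]].
  - exists 1%R; split; [lra|]; intros n Hn.
    replace n with 0%nat by lia; simpl; rewrite Cmod_1; lra.
  - exists (Rmin c (Cmod (qpoch A q (S n0)))); split.
    + apply Rmin_pos; [exact Hc|]; now apply Cmod_gt_0, qpoch_neq_0.
    + intros n Hn; destruct (Nat.eq_dec n (S n0)) as [->|Hne];
        [apply Rmin_r|].
      eapply Rle_trans; [apply Rmin_l|apply IH; lia]. }
destruct Hinit as [c [Hc Hinit]].
exists (c / 2)%R; split; [lra|]; intros n.
destruct (Nat.le_gt_cases n n0) as [Hn|Hn].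
- specialize (Hinit n Hn); lra.
- replace n with (n0 + (n - n0))%nat by lia.
  rewrite qpoch_add, Cmod_mult.
  specialize (Hinit n0 (le_n n0)); specialize (Hn0 (n - n0)%nat).
  replace (c / 2)%R with (c * (1 / 2))%R by field.
  apply Rmult_le_compat; lra.
Qed.

Lemma ctends_qpoch (A q : C) : Cmod q < 1 ->
  ctends (qpoch A q) (qpoch_inf A q).
Proof. intros Hq; apply ctends_filterlim, qpoch_inf_correct, Hq. Qed.

Lemma qpoch_inf_neq_0 (A q : C) : Cmod q < 1 ->
  (forall k, A * q ^ k <> 1) -> qpoch_inf A q <> 0.
Proof.
intros Hq HA; destruct (qpoch_bounded_below A q Hq HA) as [c [Hc Hn]].
apply Cmod_gt_0.
assert (H := ctends_Cmod_ge _ _ c (ctends_qpoch A q Hq) Hn); lra.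
Qed.

Lemma ctends_qpoch_inv (A q : C) : Cmod q < 1 ->
  (forall k, A * q ^ k <> 1) ->
  ctends (fun n => / qpoch A q n) (/ qpoch_inf A q).
Proof.
intros Hq HA; destruct (qpoch_bounded_below A q Hq HA) as [c [Hc Hn]].
now apply ctends_inv with c; [| |apply ctends_qpoch].
Qed.

Lemma Cmod_qpoch_inv_le (A q : C) : Cmod q < 1 ->
  (forall k, A * q ^ k <> 1) ->
  exists K, forall n, (Cmod (/ qpoch A q n) <= K)%R.
Proof.
intros Hq HA; destruct (qpoch_bounded_below A q Hq HA) as [c [Hc Hn]].
exists (/ c)%R; intros n; rewrite Cmod_inv by now apply qpoch_neq_0.
now apply Rinv_le_contravar.
Qed.

(** An inverse factor is the quotient (A;q)_n / (A;q)_(n+1), whose numerator and inverse denominator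
    are both bounded. *)
Lemma Cmod_inv_factor_le (A q : C) : Cmod q < 1 ->
  (forall k, A * q ^ k <> 1) ->
  exists K, forall n, (Cmod (/ (1 - A * q ^ n)) <= K)%R.
Proof.
intros Hq HA; destruct (Cmod_qpoch_inv_le A q Hq HA) as [K HK].
exists (exp (Cmod A / (1 - Cmod q)) * K)%R; intros n.
assert (H1 := qpoch_neq_0 A q n HA).
assert (H2 := one_minus_neq_0 _ (HA n)).
replace (/ (1 - A * q ^ n)) with (qpoch A q n * / qpoch A q (S n))
  by (simpl; field; auto).
rewrite Cmod_mult; apply Rmult_le_compat; auto using Cmod_ge_0.
now apply Cmod_qpoch_le.
Qed.

(** The slack [a] accommodates the truncated subtraction M - m. *)
Lemma eventually_ge_id (f : nat -> nat) (a : nat) :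
  (forall n, (n <= f n + a)%nat) -> filterlim f eventually eventually.
Proof.
intros Hf P [N HN]; exists (N + a)%nat; intros n Hn; apply HN.
specialize (Hf n); lia.
Qed.

(** * Limit and majorant of the partial fraction coefficients *)

(** The numerator tends to 1 although its length grows, because its base tends to 0 and the estimate
    is uniform in the length. Hence [pf_coef] tends to [weight] / (q;q)_oo. *)
Lemma ctends_tail_ratio (x q : C) (m : nat) : Cmod q < 1 ->
  ctends (fun M => qpoch (x * q ^ (M + m + 3)) q (M - m) / qpoch q q (M - m))
    (/ qpoch_inf q q).
Proof.
intros Hq; rewrite <- (Cmult_1_l (/ qpoch_inf q q)).
apply ctends_mult.
- apply (ctends_qpoch_1 _ q (fun M => M - m)%nat (Cmod x)); [exact Hq| |].
  + intros n; now apply Cmod_mult_pow_le.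
  + apply (is_lim_seq_subseq (fun n => Cmod (x * q ^ n)) 0
             (fun M => M + m + 3)%nat); [|now apply Cmod_mult_pow_lim].
    apply eventually_ge_id with 0%nat; intros; lia.
- apply (ctends_subseq (fun n => / qpoch q q n) _ (fun M => M - m)%nat).
  + apply eventually_ge_id with m; intros; lia.
  + apply ctends_qpoch_inv; [exact Hq|].
    intros k; rewrite <- Cpow_S; now apply Cpow_S_neq_1.
Qed.

(** Decay comes from binom(m+1,2) = binom(m,2) + m: one factor q^m is kept and all others are
    bounded uniformly. The bound also covers m > M, where M - m truncates to 0. *)
Lemma Cmod_pf_coef_le (x q : C) : Cmod q < 1 ->
  exists K, forall M m, (Cmod (pf_coef x q M m) <= K * Cmod q ^ m)%R.
Proof.
intros Hq.
assert (Hq0 := Cmod_ge_0 q).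
destruct (Cmod_qpoch_inv_le q q Hq) as [K HK].
{ intros k; rewrite <- Cpow_S; now apply Cpow_S_neq_1. }
assert (HK0 : (0 <= K)%R)
  by (eapply Rle_trans; [apply Cmod_ge_0|apply (HK 0%nat)]).
set (E := exp (Cmod (x * q) / (1 - Cmod q))).
set (c := (exp (Cmod x / (1 - Cmod q)) / (1 - Cmod q) * Cmod x)%R).
exists (E * (1 + Cmod x) * K * ((1 + c) * K))%R; intros M m.
unfold pf_coef, weight, Cdiv.
rewrite !Cmod_mult, !Cmod_pow, binomial2_S, pow_add.
assert (Hb : (0 <= Cmod q ^ binomial.binomial m 2 <= 1)%R).
{ split; [now apply pow_le|].
  rewrite <- (pow1 (binomial.binomial m 2)); apply pow_incr; lra. }
assert (Hm : (0 <= Cmod q ^ m)%R) by now apply pow_le.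
replace (Cmod (-1)) with 1%R
  by (rewrite Cmod_R, Rabs_left; lra).
rewrite pow1, Rmult_1_l.
assert (H1 : (Cmod (qpoch (x * q) q (S m)) <= E)%R) by now apply Cmod_qpoch_le.
assert (H2 : (Cmod (1 - x * q ^ (2 * m + 2)) <= 1 + Cmod x)%R).
{ eapply Rle_trans; [apply Cmod_triangle|]; rewrite Cmod_1, Cmod_opp.
  apply Rplus_le_compat_l; now apply Cmod_mult_pow_le. }
assert (H3 : (Cmod (qpoch (x * q ^ (M + m + 3)) q (M - m)) <= 1 + c)%R).
{ set (P := qpoch _ _ _).
  replace P with (1 + (P - 1)) by ring.
  eapply Rle_trans; [apply Cmod_triangle|]; rewrite Cmod_1.
  apply Rplus_le_compat_l.
  eapply Rle_trans;
    [apply (Cmod_qpoch_sub_1_le _ _ (Cmod x)); auto using Cmod_mult_pow_le|].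
  apply Rmult_le_compat_l; [|now apply Cmod_mult_pow_le].
  apply Rlt_le, Rdiv_lt_0_compat; [apply exp_pos|lra]. }
specialize (HK m) as H4; specialize (HK (M - m)%nat) as H5.
replace (E * (1 + Cmod x) * K * ((1 + c) * K) * Cmod q ^ m)%R
  with (1 * Cmod q ^ m * (E * (1 + Cmod x)) * K * ((1 + c) * K))%R by ring.
repeat apply Rmult_le_compat; repeat apply Rmult_le_pos;
  solve [apply Cmod_ge_0 | apply Hb | apply Rle_refl | assumption].
Qed.

(** * The identity as the limit of the finite one *)

Theorem theorem3p1 (q x z : C)
  (hq0 : (0 < Cmod q)%R) (hq1 : (Cmod q < 1)%R)
  (hz0 : z <> 0)
  (hz : forall n : nat, (1 <= n)%nat -> z * q ^ n <> 1)
  (hx : forall n : nat, (1 <= n)%nat -> x * q ^ n <> z) :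
  exists s : C,
    is_series
      (fun k : nat =>
         let n := (k + 1)%nat in
         (-1) ^ (n - 1)
         * (qpoch (x * q) q n / qpoch q q (n - 1))
         * q ^ binomial.binomial (n + 1) 2
         * (1 / (q ^ n * (1 - z * q ^ n))
            + (x / z) / (1 - x * q ^ n / z))) s
    /\ qpoch_inf (x * q) q / (qpoch_inf (z * q) q * qpoch_inf (x * q / z) q)
       = 1 / qpoch_inf q q * s.
Proof.
set (w := x / z).
assert (Hxw : z * w = x) by (unfold w; field; exact hz0).
assert (Hz : forall n, z * q ^ S n <> 1) by (intros; apply hz; lia).
assert (Hw : forall n, w * q ^ S n <> 1).
{ intros n E; apply (hx (S n)); [lia|].
  rewrite <- Hxw, <- Cmult_assoc, E; ring. }
assert (Hqq : forall k, q * q ^ k <> 1)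
  by (intros k; rewrite <- Cpow_S; now apply Cpow_S_neq_1).
assert (Hzq : forall k, z * q * q ^ k <> 1)
  by (intros k; rewrite <- Cmult_assoc, <- Cpow_S; auto).
assert (Hwq : forall k, w * q * q ^ k <> 1)
  by (intros k; rewrite <- Cmult_assoc, <- Cpow_S; auto).
assert (Hq : q <> 0) by now apply Cmod_gt_0.
replace (x * q / z) with (w * q) by (unfold w; field; exact hz0).
set (Q := qpoch_inf q q).
assert (HQ : Q <> 0) by now apply qpoch_inf_neq_0.
set (L := qpoch_inf (x * q) q / (qpoch_inf (z * q) q * qpoch_inf (w * q) q)).
set (D := fun m => (1 - z * q ^ S m) * (1 - w * q ^ S m)).
(* Dominated convergence applied to [partial_fractions]; the limit 1/Q of the tail ratios stays
   inside the terms for now. *)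
assert (HL : is_series (K := C_AbsRing) (V := C_NormedModule)
               (fun m => weight x q m * / Q * / D m) L).
{ destruct (Cmod_pf_coef_le x q hq1) as [K HK].
  destruct (Cmod_inv_factor_le (z * q) q hq1 Hzq) as [Kz HKz].
  destruct (Cmod_inv_factor_le (w * q) q hq1 Hwq) as [Kw HKw].
  apply is_series_of_dominated
    with (a := fun M m => pf_coef x q M m * / D m)
         (B := fun m => (Kz * Kw * K * Cmod q ^ m)%R).
  - intros m; apply (ctends_mult (fun M => pf_coef x q M m) (fun _ => / D m));
      [|apply ctends_const].
    apply (ctends_mult (fun _ => weight x q m)); [apply ctends_const|].
    now apply ctends_tail_ratio.
  - intros M m; unfold D.
    specialize (HK M m); specialize (HKz m); specialize (HKw m).
    rewrite <- Cmult_assoc, <- Cpow_S in HKz, HKw.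
    assert (H1 := one_minus_neq_0 _ (Hz m)).
    assert (H2 := one_minus_neq_0 _ (Hw m)).
    replace (/ ((1 - z * q ^ S m) * (1 - w * q ^ S m)))
      with (/ (1 - z * q ^ S m) * / (1 - w * q ^ S m)) by (field; auto).
    rewrite !Cmod_mult, Rmult_comm, (Rmult_assoc (Kz * Kw)).
    apply Rmult_le_compat; auto using Cmod_ge_0.
    { apply Rmult_le_pos; apply Cmod_ge_0. }
    apply Rmult_le_compat; auto using Cmod_ge_0.
  - apply (ex_series_scal (K := R_AbsRing) (V := R_NormedModule)
             (Kz * Kw * K)%R (fun m => Cmod q ^ m)%R).
    apply ex_series_geom; rewrite Rabs_pos_eq; [exact hq1|apply Cmod_ge_0].
  (* The row sums are replaced by their closed form, whose three symbols run along subsequences of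
     convergent sequences. *)
  - apply (is_lim_seq_ext (fun M => Cmod (qpoch (x * q) q (2 * M + 2)
        * (/ qpoch (z * q) q (S M) * / qpoch (w * q) q (S M)) - L))).
    { intros M; f_equal; f_equal; symmetry.
      rewrite <- Hxw; unfold Cdiv in *.
      etransitivity; [apply (partial_fractions q z w M hq1 Hz Hw)|].
      field; split; now apply qpoch_neq_0. }
    assert (HLE : L = qpoch_inf (x * q) q
              * (/ qpoch_inf (z * q) q * / qpoch_inf (w * q) q)).
    { unfold L; field; split; now apply qpoch_inf_neq_0. }
    rewrite HLE.
    apply (ctends_mult (fun M => qpoch (x * q) q (2 * M + 2))
             (fun M => / qpoch (z * q) q (S M) * / qpoch (w * q) q (S M))).
    + apply (ctends_subseq (qpoch (x * q) q) _ (fun M => 2 * M + 2)%nat);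
        [|now apply ctends_qpoch].
      apply eventually_ge_id with 0%nat; intros; lia.
    + apply (ctends_mult (fun M => / qpoch (z * q) q (S M))
               (fun M => / qpoch (w * q) q (S M)));
      [apply (ctends_subseq (fun n => / qpoch (z * q) q n) _ S)
      |apply (ctends_subseq (fun n => / qpoch (w * q) q n) _ S)];
      try (now apply ctends_qpoch_inv);
      apply eventually_ge_id with 0%nat; intros; lia. }
(* The series in [HL] carries 1/Q in each term, so the sum without it is Q L. *)
exists (Q * L); split; [|field; exact HQ].
apply (is_series_scal (K := C_AbsRing) (V := C_NormedModule) Q) in HL.
eapply is_series_ext; [|exact HL].
intros m; cbv zeta.
match goal with |- ?u = ?v => change (u = v :> C) end.
change (scal Q ?t) with (Q * t).
replace (m + 1 + 1)%nat with (S (S m)) by lia.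
replace (m + 1 - 1)%nat with m by lia.
replace (m + 1)%nat with (S m) by lia.
(* With n = m + 1, binom(n+1,2) = binom(n,2) + n, and the split-off q^n cancels the one in the
   common denominator q^n D_n of the bracket. *)
rewrite (binomial2_S (S m)), (Cpow_add_r q (binomial.binomial (S m) 2)).
unfold weight, D.
replace (2 * m + 2)%nat with (S m + S m)%nat by lia.
replace (x * q ^ S m / z) with (w * q ^ S m) by (unfold w; field; exact hz0).
rewrite Cpow_add_r.
replace (x * (q ^ S m * q ^ S m)) with (z * w * (q ^ S m * q ^ S m))
  by now rewrite Hxw.
assert (H1 := one_minus_neq_0 _ (Hz m)).
assert (H2 := one_minus_neq_0 _ (Hw m)).
assert (H3 := qpoch_neq_0 q q m Hqq).
assert (H4 := Cpow_nz q (S m) Hq).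
set (a := q ^ S m) in *.
field; auto.
Qed.
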